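(* Assume that $\mathcal A$ is $M$-localizable. Let $G_0\subset G$ be finite, $b=\sum_{g\in G_0}a_gU_g$ with $a_g\in\mathcal A$, and $\tilde a=\sum_{g\in G_0}\alpha_g^{-1}(a_g^*a_g)$. If for every non-empty open set $V\subset M$ there is an element $z_V\in\mathcal Z(V)$ satisfying $$\|z_Vb^*b\|\ge\|z_V\tilde a\| ,$$ then $\|a_e\|\le\|b\|$. In fact, it suffices that for every non-empty open $V\subset M$ there is $z_V\in\mathcal Z(V)$ such that $\|z_Vb^*b\|\ge\nu(z_V\tilde a)$ for every pure state $\nu\in\mathcal P_{\mathcal A}$ with $z_V(m_\nu)=1$, where $m_\nu=\nu|_{\mathcal Z}$.
   Context: Setting. $H$ is a Hilbert space, $\mathcal A\subset B(H)$ is a unital $C^*$-subalgebra with $1_{\mathcal A}=I$, $G$ is a discrete group with identity $e$, $U:G\to B(H)$, $g\mapsto U_g$, is a unitary representation, and $\mathcal Z$ is a central $C^*$-subalgebra of $\mathcal A$ with $1_{\mathcal A}\in\mathcal Z$. It is assumed that for every $g\in G$, $\alpha_g(a)=U_gaU_g^*$ defines a $*$-automorphism of both $\mathcal A$ and $\mathcal Z$. $M$ is the compact Hausdorff maximal ideal (character) space of $\mathcal Z$, and $\mathcal Z$ is identified with $C(M)$ by the Gelfand transform. For a non-empty open $V\subset M$, $\mathcal Z(V)=\{z\in C(M):0\le z\le1,\ \|z\|=1,\ \mathrm{supp}\,z\subset V\}$. Convention: $a_e:=0$ if $e\notin G_0$. $M$-localizable: let $\mathcal P_{\mathcal A}$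 be the set of pure states of $\mathcal A$ with the weak-$*$ topology and $\psi:\mathcal P_{\mathcal A}\to M$, $\mu\mapsto\mu|_{\mathcal Z}$ (restriction, a character of $\mathcal Z$, hence a point of $M$). $\mathcal A$ is $M$-localizable if $\psi(W)$ is open in $M$ for every open $W\subset\mathcal P_{\mathcal A}$. *)

(* Defs.v *)
From HB Require Import structures.
From mathcomp Require Import all_boot all_order all_algebra.
From mathcomp Require Import all_classical all_reals all_analysis.
From mathcomp Require Import complex sesquilinear finmap.

Set Implicit Arguments.
Unset Strict Implicit.
Unset Printing Implicit Defensive.

Import Order.TTheory GRing.Theory Num.Theory.
Import numFieldNormedType.Exports.

Local Open Scope classical_set_scope.
Local Open Scope ring_scope.
Local Open Scope complex_scope.

Section Operators.
Context {R : realType} {H : completeNormedModType R[i]}.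

(* The library's forms [{dot H for conj}] are linear in the first argument,
   conjugate-linear in the second one and positive definite.  Together with the
   completeness of [H], this equation makes [H] a complex Hilbert space. *)
Definition hilbert_dot (dot : {dot H for (@Num.conj R[i])}) : Prop :=
  forall x : H, `|x| ^+ 2 = dot x x.

(* Operators are plain functions [H -> H], with pointwise addition and scaling
   and with composition as product; [idfun] is the identity operator. *)
Definition bounded_operator : set (H -> H) :=
  [set T | linear T /\ exists K : R, forall x, `|T x| <= K%:C * `|x|].

(* [R[i]]-valued norms are nonnegative reals, so [complex.Re] loses nothing. *)
Definition opnorm (T : H -> H) : R :=
  sup [set complex.Re `|T x| | x in [set x : H | `|x| <= 1]].

Variable dot : {dot H for (@Num.conj R[i])}.

(* At most one [S] satisfies the condition since [dot] is positive definite,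
   and on a Hilbert space one exists for every bounded [T]. *)
Definition adj (T : H -> H) : H -> H :=
  xget (fun=> 0) [set S : H -> H | forall x y, dot (T x) y = dot x (S y)].

Record cstar_subalgebra (A : set (H -> H)) : Prop := CstarSubalgebra {
  cstar_bounded : A `<=` bounded_operator;
  cstar0 : A (fun=> 0);
  cstar_linear : forall (c : R[i]) S T, A S -> A T -> A (c *: S + T);
  cstar_comp : forall S T, A S -> A T -> A (S \o T);
  cstar_adj : forall T, A T -> A (adj T);
  cstar_closed : forall T, bounded_operator T ->
    (forall e : R, 0 < e -> exists2 S, A S & opnorm (T - S) < e) -> A T }.

Definition star_automorphism (A : set (H -> H)) (f : (H -> H) -> (H -> H)) :
    Prop :=
  [/\ set_bij A A f,
      forall (c : R[i]) S T, A S -> A T -> f (c *: S + T) = c *: f S + f T,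
      forall S T, A S -> A T -> f (S \o T) = f S \o f T &
      forall T, A T -> f (adj T) = adj (f T)].

Definition unitary (T : H -> H) : Prop :=
  [/\ bounded_operator T, adj T \o T = idfun & T \o adj T = idfun].

Definition unitary_rep (G : groupType) (U : G -> H -> H) : Prop :=
  [/\ forall g, unitary (U g), U 1%g = idfun &
      forall g h, U (g * h)%g = U g \o U h].

Definition alpha (G : groupType) (U : G -> H -> H) (g : G) (T : H -> H) :
  H -> H := U g \o T \o adj (U g).

(* A functional on a subalgebra [A] is encoded by its extension by [0] to all
   functions [H -> H].  Under this encoding the weak-* topology is the
   topology of pointwise convergence, the coordinates outside of [A] being
   constant. *)
Definition functional := {ptws (H -> H) -> R[i]^o}.

Definition linear_functional (A : set (H -> H)) (phi : functional) : Prop :=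
  (forall T, ~ A T -> phi T = 0) /\
  (forall (c : R[i]) S T, A S -> A T -> phi (c *: S + T) = c * phi S + phi T).

(* [A] contains [idfun] wherever this is used. *)
Definition state (A : set (H -> H)) : set functional :=
  [set phi | [/\ linear_functional A phi,
                 forall T, A T -> 0 <= phi (adj T \o T) &
                 phi idfun = 1]].

Definition pure_state (A : set (H -> H)) : set functional :=
  [set phi | state A phi /\
     forall (t : R) (phi1 phi2 : functional), 0 < t < 1 ->
       state A phi1 -> state A phi2 ->
       (forall T, phi T = t%:C * phi1 T + (1 - t)%:C * phi2 T) ->
       phi1 = phi /\ phi2 = phi].

(* The maximal ideal space, as the set of characters with the weak-* topology.
   The Gelfand transform of [z] is [fun m => m z]. *)
Definition character (Z : set (H -> H)) : set functional :=
  [set m | [/\ linear_functional Z m,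
               forall S T, Z S -> Z T -> m (S \o T) = m S * m T &
               exists T, m T != 0]].

Definition restriction (Z : set (H -> H)) (mu : functional) : functional :=
  patch (fun=> 0) Z mu.

Definition open_in (X V : set functional) : Prop :=
  exists2 O : set functional, open O & V = X `&` O.

Definition localizable (A Z : set (H -> H)) : Prop :=
  forall W : set functional, open_in (pure_state A) W ->
    open_in (character Z) (restriction Z @` W).

Definition gelfand_supp (Z : set (H -> H)) (z : H -> H) : set functional :=
  character Z `&` closure [set m | character Z m /\ m z != 0].

Definition unit_bump (Z : set (H -> H)) (V : set functional) : set (H -> H) :=
  [set z | [/\ Z z, forall m, character Z m -> 0 <= m z <= 1, opnorm z = 1 &
               gelfand_supp Z z `<=` V]].

(* The inverse of [alpha U g] is [alpha U g^-1]. *)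
Lemma alphaK (G : groupType) (U : G -> H -> H) (g : G) :
  unitary_rep U -> cancel (alpha U g) (alpha U g^-1%g).
Proof.
move=> [uU U1 UM] T.
have adjU h : adj (U h) = U h^-1%g.
  have [_ adjl _] := uU h.
  have UV : U h \o U h^-1%g = idfun by rewrite -UM mulgV U1.
  by rewrite -[LHS]/(adj (U h) \o idfun) -UV compA adjl.
rewrite /alpha !adjU invgK.
transitivity ((U g^-1%g \o U g) \o T \o (U g^-1%g \o U g)) => //.
by rewrite -UM mulVg U1.
Qed.

End Operators.

Arguments functional {R} H.

(* Main.v *)
Require Import Defs.
From HB Require Import structures.
From mathcomp Require Import all_boot all_order all_algebra.
From mathcomp Require Import all_classical all_reals all_analysis.
From mathcomp Require Import complex sesquilinear finmap ring lra.

Set Implicit Arguments.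
Unset Strict Implicit.
Unset Printing Implicit Defensive.

Import Order.TTheory GRing.Theory Num.Theory.
Import numFieldNormedType.Exports.

Local Open Scope classical_set_scope.
Local Open Scope ring_scope.
Local Open Scope complex_scope.

(** Suppose that the identity of [G] is in [G0] and that its coefficient [T] is
    not 0, and fix a real number below [opnorm T ^+ 2].  The pure states [phi]
    for which [phi (T^* T)] exceeds that number form a nonempty open set [W]
    (exists_pure_state).  Since [A] is localizable, the restrictions of the
    states in [W] to [Z] form a nonempty open set [V] of characters.  The
    hypothesis provides a bump [z] supported in [V]; it takes the value 1 at some
    character in [V], hence on some pure state [nu] of [W] (bump_attained,
    bump_pure_state).  A state with [nu z = 1] and multiplicative on [Z] does not
    see the factor [z]: [nu (z x) = nu x]
    (state_absorb).  So

      [nu (T^* T) <= nu ta = nu (z ta) <= opnorm (z b^* b) <= opnorm b ^+ 2],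

    where the first inequality holds because [ta] is [T^* T] plus positive terms
    (state_sum_ge) and the second one is the weaker hypothesis.  The stronger
    hypothesis implies it, since a state is bounded by the norm.

    The argument rests on the theory of states of a C*-algebra of operators.
    - Bounded operators have adjoints: adjP, from the Riesz representation
      (Riesz).
    - States are bounded: [1 - h] has a square root in [A] when [h] is
      self-adjoint of norm less than 1 (cstar_sqrt), so positivity controls
      [phi h] by the norm of [h] (state_le_opnorm).
    - Pure states attain the norm: by boundedness the set of states is compact
      (compact_state), and a compact set has extreme points maximizing a given
      continuous affine function (exists_extreme_maximizer). *)

(** * Complex numbers and real-valued norms *)

Section Scalars.
Variable R : realType.

Lemma ge0_RReK (z : R[i]) : 0 <= z -> (complex.Re z)%:C = z.
Proof. by move=> z0; rewrite RRe_real// ger0_real. Qed.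

(** The values at 1 and 'i of a nonnegative quadratic expression are real, which
    makes [q] and [q'] conjugate; the inequality is then the value at the
    minimum [t = - q^* / r].  With [p], [q], [q'], [r] the values of a positive
    semidefinite sesquilinear form, this is the Cauchy-Schwarz inequality; [q]
    and [q'] are separate variables because the hermitian symmetry of a state is
    obtained from its positivity, at the same time as the inequality. *)
Lemma quadratic_ge0 (p q q' r : R[i]) : 0 <= p -> 0 <= r ->
  (forall t : R[i], 0 <= p + t * q + Num.conj t * q' + t * Num.conj t * r) ->
  q' = Num.conj q /\ `|q| ^+ 2 <= p * r.
Proof.
move=> p0 r0 pos.
have rreal : r \is Num.real by rewrite ger0_real.
have qE : q' = Num.conj q.
  case: p q q' r p0 r0 pos {rreal} => [a a'] [b b'] [c c'] [d d'].
  rewrite !lecE/= => /andP[/eqP pim _] /andP[/eqP rim _] pos.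
  have := pos 1; rewrite lecE /= => /andP[/eqP im1 _].
  have := pos 'i%C; rewrite lecE /= => /andP[/eqP imi _].
  by apply/eqP; rewrite eq_complex /=; apply/andP; split; apply/eqP; lra.
split=> //; subst q'.
have [r_eq0|rn0] := eqVneq r 0.
  rewrite r_eq0 mulr0.
  have [->|qn0] := eqVneq q 0; first by rewrite normr0 expr0n.
  have nq : 0 < `|q| ^+ 2 by rewrite exprn_gt0// normr_gt0.
  (* without the term in [t * t^*] and with [q != 0], the expression is
     not bounded below: at this [t], the value is [- p - 2] *)
  have := pos (- ((p + 1) / `|q| ^+ 2) * Num.conj q).
  rewrite r_eq0 mulr0 addr0.
  have real1 : Num.conj (- ((p + 1) / `|q| ^+ 2)) = - ((p + 1) / `|q| ^+ 2).
    apply/CrealP.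
    by rewrite rpredN rpredM ?rpredD ?rpredV ?ger0_real ?exprn_ge0.
  rewrite rmorphM/= real1 conjCK -!mulrA [Num.conj q * q]mulrC -normCK.
  rewrite !mulNr !divfK ?gt_eqF// => h.
  have : 0 <= - p - 2%:R by move: h; congr (0 <= _); ring.
  rewrite subr_ge0 => h1; have : 2%:R <= (0 : R[i]).
    by apply: le_trans h1 _; rewrite oppr_le0.
  by rewrite lern0.
have rgt0 : 0 < r by rewrite lt_def rn0 r0.
have := pos (- (Num.conj q / r)).
rewrite rmorphN rmorphM/= conjCK fmorphV/= (CrealP rreal).
rewrite mulrNN !mulNr => h.
have : 0 <= p - `|q| ^+ 2 / r.
  move: h; congr (0 <= _); rewrite normCK; field.
  exact: rn0.
by rewrite subr_ge0 ler_pdivrMr.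
Qed.

End Scalars.

Section RealNorm.
Context {R : realType}.
Implicit Types V : normedZmodType R[i].

(** The norm of a normed space over [R[i]], as an element of [R], where the
    order is total and suprema exist. *)
Definition nrm {V} (x : V) : R := complex.Re `|x|.

Lemma nrmK V (x : V) : (nrm x)%:C = `|x|.
Proof. by rewrite /nrm RRe_real// normr_real. Qed.

Lemma nrm_ge0 V (x : V) : 0 <= nrm x.
Proof. by rewrite -ler0c nrmK. Qed.

Lemma nrm0 V : nrm (0 : V) = 0.
Proof. by rewrite /nrm normr0. Qed.

Lemma nrmD V (x y : V) : nrm (x + y) <= nrm x + nrm y.
Proof. by rewrite -lecR rmorphD /= !nrmK ler_normD. Qed.

Lemma nrmB V (x y : V) : nrm (x - y) = nrm (y - x).
Proof. by rewrite /nrm distrC. Qed.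

Lemma nrm_dist V (y x z : V) : nrm (x - z) <= nrm (x - y) + nrm (y - z).
Proof. by rewrite -[x - z](subrKA y) nrmD. Qed.

Lemma nrm_eq0 V (x : V) : nrm x = 0 -> x = 0.
Proof. by move=> x0; apply/normr0_eq0; rewrite -nrmK x0. Qed.

Lemma nrm_le_eps V (x : V) (C : R) : 0 <= C ->
  (forall e, 0 < e -> nrm x <= e * C) -> x = 0.
Proof.
move=> C0 xC; apply/nrm_eq0/eqP; rewrite eq_le nrm_ge0 andbT.
apply/ler_addgt0Pr => e e0; rewrite add0r.
have C1 : 0 < C + 1 by rewrite ltr_wpDl.
rewrite (le_trans (xC _ (divr_gt0 e0 C1)))// mulrAC ler_pdivrMr//.
by rewrite ler_wpM2l ?(ltW e0)// lerDl.
Qed.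

Lemma nrmZ (V : normedModType R[i]) c (x : V) : nrm (c *: x) = nrm c * nrm x.
Proof. by apply: complexI; rewrite rmorphM /= !nrmK normrZ. Qed.

Lemma nrmC (r : R) : nrm r%:C = `|r|.
Proof. by rewrite /nrm normc_def /= expr0n addr0 sqrtr_sqr. Qed.

Lemma nrm_conj (z : R[i]) : nrm (Num.conj z) = nrm z.
Proof. by rewrite /nrm norm_conjC. Qed.

Lemma Re_le_nrm (z : R[i]) : `|complex.Re z| <= nrm z.
Proof. by rewrite -lecR nrmK; exact: normc_ge_Re. Qed.

Lemma Im_le_nrm (z : R[i]) : `|complex.Im z| <= nrm z.
Proof.
rewrite /nrm normc_def /= -sqrtr_sqr ler_sqrt ?addr_ge0 ?sqr_ge0//.
by rewrite lerDr sqr_ge0.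
Qed.

Lemma ge0_nrm (z : R[i]) : 0 <= z -> z = (nrm z)%:C.
Proof. by move=> z0; rewrite nrmK ger0_norm. Qed.

Lemma real_complexX (r : R) n : (r ^+ n)%:C = r%:C ^+ n.
Proof. exact: (rmorphXn (real_complex R)). Qed.

Lemma real_complexM (r s : R) : (r * s)%:C = r%:C * s%:C.
Proof. exact: (rmorphM (real_complex R)). Qed.

Lemma conj_real_complex (r : R) : Num.conj r%:C = r%:C :> R[i].
Proof. exact: conjc_real. Qed.

Lemma addCJ (z : R[i]) : z + Num.conj z = (2 * complex.Re z)%:C.
Proof.
case: z => a b; apply/eqP; rewrite eq_complex /=.
by apply/andP; split; apply/eqP; lra.
Qed.

Lemma cauchy_complete (V : completeNormedModType R[i]) (u : nat -> V) :
  (forall e : R, 0 < e -> exists N, forall m n, (N <= m)%N -> (N <= n)%N ->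
    nrm (u m - u n) <= e) ->
  exists l, forall e : R, 0 < e -> exists N, forall n, (N <= n)%N ->
    nrm (u n - l) <= e.
Proof.
move=> uC.
have cu : cvg (u @ \oo).
  apply/cauchy_cvgP/cauchy_exP => eps eps0.
  have epsE := ge0_RReK (ltW eps0).
  have e2 : 0 < complex.Re eps / 2 by rewrite divr_gt0// -ltcR epsE.
  have [N uN] := uC _ e2.
  exists (u N); exists N => // n /= Nn.
  rewrite -ball_normE /= -nrmK -epsE ltcR (le_lt_trans (uN _ _ _ Nn))//.
  by rewrite ltr_pdivrMr// ltr_pMr ?ltr1n// -ltcR epsE.
exists (lim (u @ \oo)) => e e0.
have /cvgrPdist_le/(_ e%:C) := cu; rewrite ltcR => /(_ e0)[N _ uN].
by exists N => n /uN; rewrite -nrmK lecR nrmB.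
Qed.

Lemma invSn_lt (e : R) : 0 < e ->
  exists N, forall n, (N <= n)%N -> n.+1%:R^-1 < e.
Proof.
move=> e0; have [N _ hN] := near_infty_natSinv_lt (PosNum e0).
by exists N => n /hN.
Qed.

End RealNorm.

(** * Hilbert spaces and the Riesz representation *)

Section Hilbert.
Context {R : realType} {H : completeNormedModType R[i]}.
Variable dot : {dot H for (@Num.conj R[i])}.
Hypothesis hilbH : hilbert_dot dot.
Implicit Types (x y h : H) (S T : H -> H).

Lemma dotC x y : dot x y = Num.conj (dot y x).
Proof. by rewrite hermC /= expr0 mul1r. Qed.

Lemma dotDl x y h : dot (x + y) h = dot x h + dot y h.
Proof. exact: linearDl. Qed.

Lemma dotDr x y h : dot h (x + y) = dot h x + dot h y.
Proof. exact: linearDr. Qed.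

Lemma dotBr x y h : dot h (x - y) = dot h x - dot h y.
Proof. exact: linearBr. Qed.

Lemma dotZl c x y : dot (c *: x) y = c * dot x y.
Proof. exact: linearZl_LR. Qed.

Lemma dotZr c x y : dot x (c *: y) = Num.conj c * dot x y.
Proof. exact: linearZr_LR. Qed.

Lemma dotxx x : dot x x = (nrm x ^+ 2)%:C.
Proof. by rewrite -hilbH -nrmK real_complexX. Qed.

Lemma dot_inj x y : (forall h, dot h x = dot h y) -> x = y.
Proof.
by move=> xy; apply/eqP; rewrite -subr_eq0 -(dnorm_eq0 dot) dotBr xy subrr.
Qed.

Lemma CauchySchwarz_nrm x y : nrm (dot x y) <= nrm x * nrm y.
Proof.
have pos t : 0 <= dot x x + t * dot y x + Num.conj t * dot x y
    + t * Num.conj t * dot y y.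
  suff -> : dot x x + t * dot y x + Num.conj t * dot x y
    + t * Num.conj t * dot y y = dot (x + t *: y) (x + t *: y).
    exact: dnorm_ge0.
  by rewrite !(dotDl, dotDr) !(dotZl, dotZr); ring.
have [-> le] := quadratic_ge0 (dnorm_ge0 dot x) (dnorm_ge0 dot y) pos.
rewrite nrm_conj; move: le; rewrite !dotxx -nrmK -real_complexX -real_complexM.
by rewrite lecR -exprMn ler_pXn2r ?nnegrE ?mulr_ge0 ?nrm_ge0.
Qed.

Section Riesz.
Variable f : H -> R[i].
Hypothesis f_lin : forall a u v, f (a *: u + v) = a * f u + f v.
Variable K : R.
Hypothesis f_bnd : forall x, nrm (f x) <= K * nrm x.

(** If [f] is represented by [x0], then [J x] is [nrm (x - x0) ^+ 2] up to a
    constant. *)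
Let J x := nrm x ^+ 2 - 2 * complex.Re (f x).

(** A vector at which [J] is within [e ^+ 2] of its infimum is nearly critical:
    the growth of [J] in the direction of [h] is a quadratic expression whose
    linear coefficient is [dot h x - f h]. *)
Lemma nearly_represented (e : R) : 0 < e ->
  exists x, forall h, nrm (dot h x - f h) <= e * nrm h.
Proof.
move=> e0.
have infJ : has_inf (range J).
  split; first by exists (J 0), 0.
  exists (- K ^+ 2) => _ [x _ <-]; rewrite /J.
  have : complex.Re (f x) <= K * nrm x.
    by rewrite (le_trans (ler_norm _))// (le_trans (Re_le_nrm _)).
  have := sqr_ge0 (nrm x - K); nra.
have [_ [x _ <-] Jx] := inf_adherent (exprn_gt0 2 e0) infJ.
exists x => h.
have pos t : 0 <= (e ^+ 2)%:C + t * (dot h x - f h)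
    + Num.conj t * Num.conj (dot h x - f h) + t * Num.conj t * dot h h.
  have : inf (range J) <= J (x + t *: h).
    by apply: ge_inf; [exact: infJ.2|exists (x + t *: h)].
  move=> infle; have : 0 <= e ^+ 2 + J (x + t *: h) - J x.
    by rewrite subr_ge0 (le_trans (ltW Jx))// addrC lerD2l.
  have JE z : (J z)%:C = dot z z - (f z + Num.conj (f z)).
    by rewrite addCJ dotxx -rmorphB.
  rewrite -ler0c rmorphB rmorphD /= !JE [x + _]addrC f_lin.
  congr (0 <= _); rewrite !(dotDl, dotDr) !(dotZl, dotZr).
  rewrite !(rmorphB, rmorphD, rmorphM) /= -(dotC x h); ring.
have e2 : 0 <= (e ^+ 2)%:C :> R[i] by rewrite ler0c sqr_ge0.
have [_] := quadratic_ge0 e2 (dnorm_ge0 dot h) pos.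
rewrite dotxx -nrmK -real_complexX -real_complexM lecR -exprMn.
by rewrite ler_pXn2r ?nnegrE ?mulr_ge0 ?nrm_ge0 ?(ltW e0).
Qed.

(** Vectors that represent [f] up to [e] and up to [e'] are at distance at most
    [e + e'], by testing on their difference.  So a sequence of better and
    better representatives is a Cauchy sequence. *)
Lemma Riesz : exists x, forall h, f h = dot h x.
Proof.
have /choice[u uP] : forall n, exists x, forall h,
    nrm (dot h x - f h) <= n.+1%:R^-1 * nrm h.
  by move=> n; apply: nearly_represented; rewrite invr_gt0 ltr0n.
have udist m n : nrm (u m - u n) <= m.+1%:R^-1 + n.+1%:R^-1.
  have := nrm_ge0 (u m - u n); rewrite le_eqVlt => /orP[/eqP <-|gt0].
    by rewrite addr_ge0// invr_ge0.
  rewrite -(ler_pM2r gt0) mulrDl.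
  have -> : nrm (u m - u n) * nrm (u m - u n) =
      nrm (dot (u m - u n) (u m - u n)).
    by rewrite dotxx nrmC ger0_norm ?exprn_ge0 ?nrm_ge0// expr2.
  rewrite dotBr; apply: le_trans (nrm_dist (f (u m - u n)) _ _) _.
  by rewrite lerD// nrmB.
have [l lP] : exists l, forall e : R, 0 < e -> exists N, forall n, (N <= n)%N ->
    nrm (u n - l) <= e.
  apply: cauchy_complete => e e0.
  have e2 : 0 < e / 2 by rewrite divr_gt0.
  have [N hN] := invSn_lt e2.
  exists N => m n /hN Nm /hN Nn; apply: le_trans (udist m n) _.
  by rewrite [e]splitr lerD// ltW.
exists l => h; apply/esym/eqP; rewrite -subr_eq0; apply/eqP.
apply: (@nrm_le_eps _ _ _ (nrm h + nrm h)) => [|d d0].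
  by rewrite addr_ge0 ?nrm_ge0.
have [N1 h1] := lP _ d0; have [N2 h2] := invSn_lt d0.
have := h1 _ (leq_maxl N1 N2); have := h2 _ (leq_maxr N1 N2).
set n := maxn _ _; move=> un1 un2; have hh := nrm_ge0 h.
apply: le_trans (nrm_dist (dot h (u n)) _ _) _.
have a1 : nrm (dot h l - dot h (u n)) <= nrm h * d.
  by rewrite -dotBr (le_trans (CauchySchwarz_nrm _ _))// ler_wpM2l// nrmB.
have a2 : nrm (dot h (u n) - f h) <= d * nrm h.
  by rewrite (le_trans (uP n h))// ler_wpM2r// ltW.
lra.
Qed.

End Riesz.
End Hilbert.

(** * Bounded operators and their adjoints *)

Section Operators.
Context {R : realType} {H : completeNormedModType R[i]}.
Implicit Types (x y h : H) (S T : H -> H).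

Lemma bounded_operatorP T : bounded_operator T <->
  linear T /\ exists2 K : R, 0 <= K & forall x, nrm (T x) <= K * nrm x.
Proof.
split=> [[lT [K TK]]|[lT [K K0 TK]]]; split=> //.
  exists (Num.max K 0) => [|x]; first by rewrite le_max lexx orbT.
  have : nrm (T x) <= K * nrm x by rewrite -lecR real_complexM !nrmK.
  by move/le_trans; apply; rewrite ler_wpM2r ?nrm_ge0// le_max lexx.
by exists K => x; rewrite -!nrmK -real_complexM lecR.
Qed.

Lemma linear_op0 T : linear T -> T 0 = 0.
Proof.
by move=> lT; have := lT (-1) 0 0; rewrite scaler0 addr0 scaleN1r addNr.
Qed.

Lemma linear_opZ (c : R[i]) T x : linear T -> T (c *: x) = c *: T x.
Proof. by move=> lT; have := lT c x 0; rewrite (linear_op0 lT) !addr0. Qed.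

Lemma linear_opB T x y : linear T -> T (x - y) = T x - T y.
Proof.
by move=> lT; rewrite -[- y]scaleN1r addrC lT scaleN1r addrC.
Qed.

Lemma opnorm_le T (K : R) : 0 <= K -> (forall x, nrm (T x) <= K * nrm x) ->
  opnorm T <= K.
Proof.
move=> K0 TK; apply: ge_sup => [|_ [x /= x1 <-]].
  by exists (complex.Re `|T 0|), 0 => //=; rewrite normr0.
by rewrite (le_trans (TK x))// ler_piMr// -lecR nrmK.
Qed.

Lemma opnormP T x : bounded_operator T -> nrm (T x) <= opnorm T * nrm x.
Proof.
move=> /bounded_operatorP[lT [K K0 TK]].
have [x0|x0] := eqVneq x 0; first by rewrite x0 linear_op0// !nrm0 mulr0.
have nx0 : 0 < nrm x.
  by rewrite lt_def nrm_ge0 andbT; apply: contra x0 => /eqP/nrm_eq0 ->.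
rewrite -ler_pdivrMr//.
have nV : nrm (nrm x)^-1%:C = (nrm x)^-1.
  by rewrite nrmC ger0_norm// invr_ge0 ltW.
apply: ub_le_sup.
  exists K => _ [y /= y1 <-]; rewrite (le_trans (TK y))// ler_piMr//.
  by rewrite -lecR nrmK.
exists ((nrm x)^-1%:C *: x) => /=.
  by rewrite -nrmK nrmZ nV mulVf// gt_eqF.
by rewrite (linear_opZ _ _ lT) -/(nrm _) nrmZ nV mulrC.
Qed.

Lemma opnorm_ge0 T : bounded_operator T -> 0 <= opnorm T.
Proof.
move=> /bounded_operatorP[lT [K K0 TK]].
apply: le_trans (_ : complex.Re `|T 0| <= _); first exact: nrm_ge0.
apply: ub_le_sup; last by exists 0 => //=; rewrite normr0.
exists K => _ [y /= y1 <-]; rewrite (le_trans (TK y))// ler_piMr//.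
by rewrite -lecR nrmK.
Qed.

Lemma bounded_operator_idfun : bounded_operator (idfun : H -> H).
Proof.
by apply/bounded_operatorP; split=> //; exists 1 => // x; rewrite mul1r.
Qed.

Lemma bounded_operator0 : bounded_operator (0 : H -> H).
Proof.
apply/bounded_operatorP; split=> [c x y|]; first by rewrite /= scaler0 addr0.
by exists 0 => // x; rewrite nrm0 mul0r.
Qed.

Lemma bounded_operator_comp S T : bounded_operator S -> bounded_operator T ->
  bounded_operator (S \o T).
Proof.
move=> bS bT; apply/bounded_operatorP; split.
  by move=> c x y; rewrite /= bT.1 bS.1.
exists (opnorm S * opnorm T); first by rewrite mulr_ge0 ?opnorm_ge0.
move=> x; rewrite (le_trans (opnormP _ bS))// -mulrA.
by rewrite ler_wpM2l ?opnorm_ge0 ?opnormP.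
Qed.

Lemma opnorm_comp S T : bounded_operator S -> bounded_operator T ->
  opnorm (S \o T) <= opnorm S * opnorm T.
Proof.
move=> bS bT; apply: opnorm_le; first by rewrite mulr_ge0 ?opnorm_ge0.
move=> x; rewrite (le_trans (opnormP _ bS))// -mulrA.
by rewrite ler_wpM2l ?opnorm_ge0 ?opnormP.
Qed.

Lemma bounded_operator_linear (c : R[i]) S T :
  bounded_operator S -> bounded_operator T -> bounded_operator (c *: S + T).
Proof.
move=> bS bT; apply/bounded_operatorP; split.
  move=> d x y; rewrite !fctE bT.1 bS.1 !scalerDr !scalerA [d * c]mulrC.
  by rewrite [RHS]addrACA.
exists (nrm c * opnorm S + opnorm T).
  by rewrite addr_ge0 ?mulr_ge0 ?opnorm_ge0 ?nrm_ge0.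
move=> x; rewrite !fctE (le_trans (nrmD _ _))// nrmZ mulrDl -mulrA.
by rewrite lerD ?opnormP// ler_wpM2l ?nrm_ge0 ?opnormP.
Qed.

Lemma bounded_operator_sum (I : eqType) (s : seq I) (F : I -> H -> H) :
  (forall i, i \in s -> bounded_operator (F i)) ->
  bounded_operator (\sum_(i <- s) F i).
Proof.
move=> bF; rewrite big_seq.
elim/big_ind: _ => [|S T bS bT|i /bF//]; first exact: bounded_operator0.
by have := bounded_operator_linear 1 bS bT; rewrite scale1r.
Qed.

Section Adjoint.
Variable dot : {dot H for (@Num.conj R[i])}.
Hypothesis hilbH : hilbert_dot dot.

(** The definition of [adj] falls back on 0 when no adjoint exists; the Riesz
    representation of [dot (T _) y] excludes this for a bounded [T]. *)
Lemma adjP T : bounded_operator T ->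
  forall x y, dot (T x) y = dot x (adj dot T y).
Proof.
move=> bT; have [lT _] := bT.
suff : exists S, forall x y, dot (T x) y = dot x (S y).
  exact: (@xgetPex _ (fun=> 0) [set S | forall x y, dot (T x) y = dot x (S y)]).
have /choice[S SP] : forall y, exists s, forall x, dot (T x) y = dot x s.
  move=> y; apply: (@Riesz _ _ dot hilbH _ _ (opnorm T * nrm y)) => [c u v|x].
    by rewrite lT dotDl dotZl.
  rewrite (le_trans (CauchySchwarz_nrm hilbH _ _))// mulrAC.
  by rewrite ler_wpM2r ?nrm_ge0 ?opnormP.
by exists S => x y; exact: SP.
Qed.

Lemma adj_uniq S T : bounded_operator T ->
  (forall x y, dot (T x) y = dot x (S y)) -> adj dot T = S.
Proof.
move=> bT ST; apply/funext => y; apply: (dot_inj (dot := dot)) => x.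
by rewrite -(adjP bT) ST.
Qed.

Lemma adj_le T x : bounded_operator T -> nrm (adj dot T x) <= opnorm T * nrm x.
Proof.
move=> bT; set u := adj dot T x.
have := nrm_ge0 u; rewrite le_eqVlt => /orP[/eqP <-|u0].
  by rewrite mulr_ge0 ?nrm_ge0 ?opnorm_ge0.
rewrite -(ler_pM2r u0).
have -> : nrm u * nrm u = nrm (dot (T u) x).
  by rewrite (adjP bT) (dotxx hilbH) nrmC ger0_norm ?exprn_ge0 ?nrm_ge0// expr2.
rewrite (le_trans (CauchySchwarz_nrm hilbH _ _))// mulrAC.
by rewrite ler_wpM2r ?nrm_ge0// opnormP.
Qed.

Lemma bounded_operator_adj T : bounded_operator T ->
  bounded_operator (adj dot T).
Proof.
move=> bT; apply/bounded_operatorP; split; last first.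
  by exists (opnorm T) => [|x]; [exact: opnorm_ge0|exact: adj_le].
move=> c x y; apply: (dot_inj (dot := dot)) => h.
by rewrite -(adjP bT) !dotDr !dotZr -!(adjP bT).
Qed.

Lemma opnorm_adj T : bounded_operator T -> opnorm (adj dot T) <= opnorm T.
Proof.
by move=> bT; apply: opnorm_le => [|x]; [exact: opnorm_ge0|exact: adj_le].
Qed.

Lemma adjK T : bounded_operator T -> adj dot (adj dot T) = T.
Proof.
move=> bT; apply: adj_uniq; first exact: bounded_operator_adj.
by move=> x y; rewrite dotC -(adjP bT) -dotC.
Qed.

Lemma adj_comp S T : bounded_operator S -> bounded_operator T ->
  adj dot (S \o T) = adj dot T \o adj dot S.
Proof.
move=> bS bT; apply: adj_uniq; first exact: bounded_operator_comp.
by move=> x y; rewrite /= (adjP bS) (adjP bT).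
Qed.

Lemma adjZ (c : R[i]) T : bounded_operator T ->
  adj dot (c *: T) = Num.conj c *: adj dot T.
Proof.
move=> bT; apply: adj_uniq => [|x y].
  by have := bounded_operator_linear c bT bounded_operator0; rewrite addr0.
by rewrite !fctE dotZl dotZr conjCK (adjP bT).
Qed.

Lemma adjD S T : bounded_operator S -> bounded_operator T ->
  adj dot (S + T) = adj dot S + adj dot T.
Proof.
move=> bS bT; apply: adj_uniq => [|x y].
  by have := bounded_operator_linear 1 bS bT; rewrite scale1r.
by rewrite !fctE dotDl dotDr (adjP bS) (adjP bT).
Qed.

Lemma adj0 : adj dot 0 = 0 :> (H -> H).
Proof.
apply: adj_uniq => [|x y]; first exact: bounded_operator0.
by rewrite -[LHS]/(dot 0 y) -[RHS]/(dot x 0) linear0l linear0r.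
Qed.

Lemma adj_idfun : adj dot idfun = idfun.
Proof. by apply: adj_uniq => //; exact: bounded_operator_idfun. Qed.

End Adjoint.
End Operators.

(** * Square roots in a C*-algebra of operators *)

Section Algebra.
Context {R : realType} {H : completeNormedModType R[i]}.
Variable dot : {dot H for (@Num.conj R[i])}.
Hypothesis hilbH : hilbert_dot dot.
Variable A : set (H -> H).
Hypothesis cstarA : cstar_subalgebra dot A.
Implicit Types (x y h : H) (S T : H -> H).

Lemma cstar_scale (c : R[i]) T : A T -> A (c *: T).
Proof.
by move=> AT; have := cstar_linear cstarA c AT (cstar0 cstarA); rewrite addr0.
Qed.

Lemma cstar_add S T : A S -> A T -> A (S + T).
Proof.
by move=> AS AT; have := cstar_linear cstarA 1 AS AT; rewrite scale1r.
Qed.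

Lemma cstar_sub S T : A S -> A T -> A (S - T).
Proof.
move=> AS AT; apply: cstar_add => //; rewrite -scaleN1r.
exact: cstar_scale.
Qed.

Lemma cstar_sum (I : eqType) (s : seq I) (F : I -> H -> H) :
  (forall i, i \in s -> A (F i)) -> A (\sum_(i <- s) F i).
Proof.
move=> AF; rewrite big_seq; elim/big_ind: _ => [|S T AS AT|i /AF//].
  exact: (cstar0 cstarA).
exact: cstar_add.
Qed.

(** The uniform limit is first built pointwise, by completeness of [H]. *)
Lemma cstar_complete (u : nat -> H -> H) : (forall n, A (u n)) ->
  (forall e : R, 0 < e -> exists N, forall m n, (N <= m)%N -> (N <= n)%N ->
    forall x, nrm (u m x - u n x) <= e * nrm x) ->
  exists2 T, A T & forall e : R, 0 < e -> exists N, forall n, (N <= n)%N ->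
    forall x, nrm (u n x - T x) <= e * nrm x.
Proof.
move=> Au uC.
have /choice[T TP] x : exists l, forall e : R, 0 < e ->
    exists N, forall n, (N <= n)%N -> nrm (u n x - l) <= e.
  apply: cauchy_complete => e e0.
  have x0 : 0 < 1 + nrm x by rewrite ltr_wpDr ?nrm_ge0.
  have [N NP] := uC (e / (1 + nrm x)) (divr_gt0 e0 x0).
  exists N => m n Nm Nn; rewrite (le_trans (NP m n Nm Nn x))//.
  by rewrite mulrAC ler_pdivrMr// ler_wpM2l ?(ltW e0)// lerDr.
have unif e : 0 < e -> exists N, forall n, (N <= n)%N ->
    forall x, nrm (u n x - T x) <= e * nrm x.
  move=> e0; have [N NP] := uC e e0; exists N => n Nn x.
  apply/ler_addgt0Pr => d d0; have [N' N'P] := TP x d d0.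
  rewrite (le_trans (nrm_dist (u (maxn N N') x) _ _))// lerD//.
    by apply: NP => //; rewrite leq_maxl.
  by apply: N'P; rewrite leq_maxr.
have bu n : bounded_operator (u n) := cstar_bounded cstarA (Au n).
have bT : bounded_operator T.
  apply/bounded_operatorP; split=> [c x y|].
    apply/eqP; rewrite -subr_eq0; apply/eqP.
    apply: (@nrm_le_eps _ _ _ (2 + nrm c)) => [|d d0].
      by rewrite addr_ge0 ?nrm_ge0.
    have [N1 P1] := TP (c *: x + y) d d0.
    have [N2 P2] := TP x d d0; have [N3 P3] := TP y d d0.
    pose n := maxn N1 (maxn N2 N3).
    have {}P1 : nrm (u n (c *: x + y) - T (c *: x + y)) <= d.
      by apply: P1; rewrite !leq_max leqnn.
    have {}P2 : nrm (u n x - T x) <= d.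
      by apply: P2; rewrite !leq_max leqnn orbT.
    have {}P3 : nrm (u n y - T y) <= d.
      by apply: P3; rewrite !leq_max leqnn !orbT.
    rewrite (bu n).1 nrmB in P1.
    rewrite (le_trans (nrm_dist (c *: u n x + u n y) _ _))//.
    have -> : d * (2 + nrm c) = d + (nrm c * d + d) by ring.
    rewrite lerD// opprD addrACA -scalerBr (le_trans (nrmD _ _))// lerD//.
    by rewrite nrmZ ler_wpM2l ?nrm_ge0.
  have [N NP] := unif 1 ltr01.
  exists (opnorm (u N) + 1); first by rewrite addr_ge0 ?opnorm_ge0.
  move=> x; rewrite mulrDl.
  have -> : T x = u N x - (u N x - T x) by rewrite opprB addrC subrK.
  rewrite (le_trans (nrmD _ _))// lerD ?opnormP//.
  by rewrite -[- _]sub0r nrmB subr0 NP.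
exists T => //; apply: (cstar_closed cstarA bT) => e e0.
have e2 : 0 < e / 2 by rewrite divr_gt0.
have [N NP] := unif _ e2; exists (u N) => //.
apply: le_lt_trans (_ : e / 2 < e); last first.
  by rewrite ltr_pdivrMr// ltr_pMr ?ltr1n.
apply: opnorm_le; first exact: ltW.
by move=> x; rewrite fctE nrmB NP.
Qed.

Lemma cstar_geometric (u : nat -> H -> H) (r : R) : 0 <= r < 1 ->
  (forall n, A (u n)) ->
  (forall n x, nrm (u n.+1 x - u n x) <= r ^+ n * nrm x) ->
  exists2 T, A T & forall e : R, 0 < e -> exists N, forall n, (N <= n)%N ->
    forall x, nrm (u n x - T x) <= e * nrm x.
Proof.
move=> /andP[r0 r1] Au ur; apply: cstar_complete => // e e0.
have s0 : 0 < 1 - r by rewrite subr_gt0.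
have geo n k x : (1 - r) * nrm (u (n + k)%N x - u n x) <=
    (r ^+ n - r ^+ (n + k)) * nrm x.
  elim: k => [|k IH]; first by rewrite addn0 !subrr nrm0 mulr0 mul0r.
  rewrite addnS.
  have le0 := ler_wpM2l (ltW s0)
    (nrm_dist (u (n + k)%N x) (u (n + k).+1 x) (u n x)).
  have le1 := ler_wpM2l (ltW s0) (ur (n + k)%N x).
  rewrite (le_trans le0)// mulrDr (le_trans (lerD le1 IH))// exprS.
  by rewrite le_eqVlt; apply/orP; left; apply/eqP; ring.
have : r ^+ n @[n --> \oo] --> 0 by apply: cvg_expr; rewrite ger0_norm.
have d0 : 0 < e * (1 - r) / 2 by rewrite !mulr_gt0// invr_gt0.
move=> /cvgrPdist_le/(_ _ d0)[N _ NP].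
have far n x : (N <= n)%N -> nrm (u n x - u N x) <= e / 2 * nrm x.
  move=> /subnKC <-; rewrite -(ler_pM2l s0) (le_trans (geo _ _ _))//.
  rewrite mulrA ler_wpM2r ?nrm_ge0//.
  have := NP N (leqnn N); rewrite sub0r normrN ger0_norm ?exprn_ge0//.
  have : 0 <= r ^+ (N + (n - N)) by rewrite exprn_ge0.
  lra.
exists N => m n Nm Nn x; rewrite (le_trans (nrm_dist (u N x) _ _))//.
rewrite [X in _ + X]nrmB.
have := far m x Nm; have := far n x Nn; lra.
Qed.

Hypothesis A1 : A idfun.

(** The self-adjoint [1 - y] is a square root of [1 - h]: the equation
    [(1 - y)^2 = 1 - h] says that [y] is a fixed point of
    [y |-> (h + y^2) / 2], which contracts the ball of radius [r] by the
    factor [r]. *)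
Lemma cstar_sqrt (h : H -> H) (r : R) : A h -> adj dot h = h ->
  r < 1 -> 0 <= r -> (forall x, nrm (h x) <= r * nrm x) ->
  exists2 y, A y & adj dot (idfun - y) \o (idfun - y) = idfun - h.
Proof.
move=> Ah hh r1 r0 hr.
pose c : R[i] := (2^-1)%:C.
have nc : nrm c = 2^-1 by rewrite nrmC ger0_norm.
have cJ : Num.conj c = c := conj_real_complex _.
have cc : c + c = 1.
  by rewrite /c -(rmorphD (real_complex R)) /= -[2^-1]div1r -splitr.
pose F (y : H -> H) : H -> H := c *: (h + (y \o y)).
pose u n := iter n F 0.
have uS n : u n.+1 = F (u n) by [].
have Au n : A (u n).
  elim: n => [|n IH]; first exact: (cstar0 cstarA).
  rewrite uS; apply/cstar_scale/cstar_add => //.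
  exact: (cstar_comp cstarA IH IH).
have bA T : A T -> bounded_operator T by exact: (cstar_bounded cstarA).
have ur n x : nrm (u n x) <= r * nrm x.
  elim: n x => [|n IH] x; first by rewrite nrm0 mulr_ge0 ?nrm_ge0.
  rewrite uS /F !fctE nrmZ nc.
  have := nrmD (h x) ((u n \o u n) x); rewrite /= => le1.
  have le2 := hr x; have le3 := IH x.
  have le4 : nrm (u n (u n x)) <= r * nrm x.
    by rewrite (le_trans (IH _))// (le_trans _ (IH x))// ler_piMl ?nrm_ge0 ?ltW.
  lra.
have us n : adj dot (u n) = u n.
  elim: n => [|n IH]; first exact: adj0.
  have buu : bounded_operator (u n \o u n).
    by apply: bounded_operator_comp; exact: bA.
  have bhu : bounded_operator (h + (u n \o u n)).
    by apply/bA/cstar_add => //; exact: (cstar_comp cstarA (Au n) (Au n)).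
  rewrite uS /F (adjZ hilbH _ bhu) (adjD hilbH (bA _ Ah) buu).
  by rewrite (adj_comp hilbH (bA _ (Au n)) (bA _ (Au n))) IH hh cJ.
have [y Ay uy] : exists2 T, A T & forall e : R, 0 < e ->
    exists N, forall n, (N <= n)%N -> forall x, nrm (u n x - T x) <= e * nrm x.
  apply: (@cstar_geometric u r) => //; first by rewrite r0 r1.
  elim=> [|n IH] x.
    rewrite expr0 mul1r subr0 (le_trans (ur _ _))//.
    by rewrite ler_piMl ?nrm_ge0// ltW.
  rewrite uS [u n.+1 in X in _ - X]uS /F !fctE -scalerBr nrmZ nc.
  rewrite [h x + _]addrC addrKA /=.
  (* [u'u' - uu = u'(u' - u) + (u' - u)u] *)
  have le1 := nrm_dist (u n.+1 (u n x)) (u n.+1 (u n.+1 x)) (u n (u n x)).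
  rewrite -(linear_opB _ _ (bA _ (Au n.+1)).1) in le1.
  have le2 := ur n.+1 (u n.+1 x - u n x).
  have le3 : r * nrm (u n.+1 x - u n x) <= r * (r ^+ n * nrm x).
    by rewrite ler_wpM2l.
  have le4 := IH (u n x).
  have le5 : r ^+ n * nrm (u n x) <= r ^+ n * (r * nrm x).
    by rewrite ler_wpM2l ?exprn_ge0.
  rewrite exprS; lra.
have ys : adj dot y = y.
  apply: (adj_uniq hilbH (bA _ Ay)) => x z.
  apply/eqP; rewrite -subr_eq0; apply/eqP.
  apply: (@nrm_le_eps _ _ _ (nrm x * nrm z *+ 2)) => [|e e0].
    by rewrite mulrn_wge0// mulr_ge0 ?nrm_ge0.
  have [N /(_ N (leqnn N)) NP] := uy e e0.
  rewrite (le_trans (nrm_dist (dot (u N x) z) _ _))// mulr2n mulrDr lerD//.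
    rewrite nrmB -linearBl (le_trans (CauchySchwarz_nrm hilbH _ _))// mulrA.
    by rewrite ler_wpM2r ?nrm_ge0.
  rewrite (adjP hilbH (bA _ (Au N))) us -linearBr.
  apply: le_trans (CauchySchwarz_nrm hilbH _ _) _; rewrite mulrCA.
  by apply: ler_wpM2l; [exact: nrm_ge0|exact: NP].
have Fy x : y x = c *: (h x + y (y x)).
  apply/eqP; rewrite -subr_eq0; apply/eqP.
  apply: (@nrm_le_eps _ _ _ (nrm x *+ 2 + nrm (y x))) => [|e e0].
    by rewrite addr_ge0 ?mulrn_wge0 ?nrm_ge0.
  have [N NP] := uy e e0.
  have le1 := nrm_dist (u N.+1 x) (y x) (c *: (h x + y (y x))).
  have le2 := NP N.+1 (leqnSn N) x; rewrite nrmB in le2.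
  have eq1 : nrm (u N.+1 x - c *: (h x + y (y x))) =
      2^-1 * nrm (u N (u N x) - y (y x)).
    by rewrite uS /F !fctE -scalerBr nrmZ nc opprD addrACA subrr add0r.
  have le3 := nrm_dist (u N (y x)) (u N (u N x)) (y (y x)).
  rewrite -(linear_opB _ _ (bA _ (Au N)).1) in le3.
  have le4 := ur N (u N x - y x).
  have le5 := NP N (leqnn N) x; have le6 := NP N (leqnn N) (y x).
  have le7 : r * nrm (u N x - y x) <= nrm (u N x - y x).
    by rewrite ler_piMl ?nrm_ge0 ?ltW.
  have le8 : 0 <= e * nrm x by rewrite mulr_ge0 ?nrm_ge0 ?ltW.
  have le9 : 0 <= e * nrm (y x) by rewrite mulr_ge0 ?nrm_ge0 ?ltW.
  rewrite mulr2n !mulrDr; lra.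
exists y => //.
have -> : adj dot (idfun - y) = idfun - y.
  have bNy : bounded_operator (-1 *: y) by apply/bA/cstar_scale.
  rewrite -[- y]scaleN1r (adjD hilbH (bA _ A1) bNy) (adj_idfun hilbH).
  by rewrite (adjZ hilbH _ (bA _ Ay)) ys rmorphN1.
apply/funext => x; rewrite !fctE /= (linear_opB _ _ (bA _ Ay).1).
have : y x + y x = h x + y (y x) by rewrite {1 2}Fy -scalerDl cc scale1r.
move=> yyx; have -> : h x = y x + y x - y (y x) by rewrite yyx addrK.
by rewrite !opprD !opprK !addrA.
Qed.

End Algebra.

(** * States *)

Section States.
Context {R : realType} {H : completeNormedModType R[i]}.
Variable dot : {dot H for (@Num.conj R[i])}.
Hypothesis hilbH : hilbert_dot dot.
Variable A : set (H -> H).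
Hypotheses (cstarA : cstar_subalgebra dot A) (A1 : A idfun).
Implicit Types (S T : H -> H) (phi : functional H).

Let bA T : A T -> bounded_operator T.
Proof. exact: (cstar_bounded cstarA). Qed.

Let opnormA_ge0 T : A T -> 0 <= opnorm T.
Proof. by move=> /bA; exact: opnorm_ge0. Qed.

Lemma functionalD phi S T : linear_functional A phi -> A S -> A T ->
  phi (S + T) = phi S + phi T.
Proof.
by move=> [_ lphi] AS AT; have := lphi 1 S T AS AT; rewrite scale1r mul1r.
Qed.

Lemma functional0 phi : linear_functional A phi -> phi 0 = 0.
Proof.
move=> phil; have A0 : A 0 := cstar0 cstarA.
by apply: (addrI (phi 0)); rewrite -(functionalD phil A0 A0) !addr0.
Qed.

Lemma functional_sum phi (I : eqType) (s : seq I) (F : I -> H -> H) :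
  linear_functional A phi -> (forall i, i \in s -> A (F i)) ->
  phi (\sum_(i <- s) F i) = \sum_(i <- s) phi (F i).
Proof.
move=> phil; elim: s => [|i s IH] AF; first by rewrite !big_nil functional0.
have As j : j \in s -> A (F j) by move=> js; apply: AF; rewrite inE js orbT.
rewrite !big_cons functionalD ?IH//; first by apply: AF; rewrite mem_head.
exact: (cstar_sum cstarA).
Qed.

(** Positivity of [phi] on all the [(t T + S)^* (t T + S)]. *)
Lemma state_CauchySchwarz phi S T : state dot A phi -> A S -> A T ->
  phi (adj dot T \o S) = Num.conj (phi (adj dot S \o T)) /\
  `|phi (adj dot S \o T)| ^+ 2 <=
    phi (adj dot S \o S) * phi (adj dot T \o T).
Proof.
move=> [[phi0 philin] phipos phi1] AS AT.
have AC P Q : A P -> A Q -> A (adj dot P \o Q).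
  by move=> AP AQ; apply: (cstar_comp cstarA) => //; exact: (cstar_adj cstarA).
apply: quadratic_ge0; [exact: phipos|exact: phipos|move=> t].
have Atl : A (t *: T + S) := cstar_linear cstarA t AT AS.
have := phipos _ Atl.
have -> : adj dot (t *: T + S) \o (t *: T + S) =
    (t * Num.conj t) *: (adj dot T \o T) + (t *: (adj dot S \o T) +
      (Num.conj t *: (adj dot T \o S) + (adj dot S \o S))).
  have bt : bounded_operator (t *: T) by apply/bA/(cstar_scale cstarA).
  rewrite (adjD hilbH bt (bA AS)) (adjZ hilbH _ (bA AT)).
  have lT : linear (adj dot T) by case: (bounded_operator_adj hilbH (bA AT)).
  have lS : linear (adj dot S) by case: (bounded_operator_adj hilbH (bA AS)).
  apply/funext => x; rewrite !fctE /= lT lS scalerDr scalerA [_ * t]mulrC.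
  by rewrite -!addrA; congr (_ + _); rewrite addrCA.
have A4 := cstar_linear cstarA (Num.conj t) (AC _ _ AT AS) (AC _ _ AS AS).
have A3 := cstar_linear cstarA t (AC _ _ AS AT) A4.
rewrite (philin _ _ _ (AC _ _ AT AT) A3) (philin _ _ _ (AC _ _ AS AT) A4).
rewrite (philin _ _ _ (AC _ _ AT AS) (AC _ _ AS AS)).
by congr (0 <= _); ring.
Qed.

(** For [c > opnorm h], the element [1 - h / c] is a square [s^* s], on which
    [phi] is nonnegative.  States are defined by positivity alone: this is where
    the completeness of [A] makes them continuous. *)
Lemma state_Re_le_opnorm phi h : state dot A phi -> A h -> adj dot h = h ->
  complex.Re (phi h) <= opnorm h.
Proof.
move=> [[phi0 philin] phipos phi1] Ah hh; apply/ler_addgt0Pr => e e0.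
have c0 : 0 < opnorm h + e by rewrite ltr_wpDl ?opnormA_ge0.
set c := opnorm h + e in c0 *; pose d : R[i] := c^-1%:C.
have Adh : A (d *: h) := cstar_scale cstarA d Ah.
have [y Ay yP] : exists2 y, A y &
    adj dot (idfun - y) \o (idfun - y) = idfun - d *: h.
  apply: (@cstar_sqrt _ _ _ hilbH _ cstarA A1 _ (opnorm h / c)) => //.
  - by rewrite (adjZ hilbH _ (bA Ah)) hh conj_real_complex.
  - by rewrite ltr_pdivrMr// mul1r ltrDl.
  - by rewrite divr_ge0 ?opnormA_ge0// ltW.
  - move=> x; rewrite fctE nrmZ nrmC ger0_norm ?invr_ge0 ?(ltW c0)//.
    rewrite mulrAC mulrC ler_wpM2r ?invr_ge0 ?(ltW c0)//.
    by apply: opnormP; exact: bA.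
have := phipos _ (cstar_sub cstarA A1 Ay).
rewrite yP addrC -scaleN1r (philin _ _ _ Adh A1) phi1.
rewrite -[d *: h]addr0 (philin _ _ _ Ah (cstar0 cstarA)).
rewrite (functional0 (conj phi0 philin)).
case: (phi h) => u v; rewrite lecE /= => /andP[_ h1].
have : u / c <= 1 by move: h1; rewrite mulrC; lra.
by rewrite ler_pdivrMr// mul1r.
Qed.

Lemma state_le_opnorm phi T : state dot A phi -> A T ->
  nrm (phi T) <= opnorm T.
Proof.
move=> sphi AT; have [_ phipos phi1] := sphi.
have [_] := state_CauchySchwarz sphi A1 AT.
rewrite (adj_idfun hilbH) phi1 mul1r.
have -> : idfun \o T = T by [].
have TT0 := phipos _ AT; set h := adj dot T \o T in TT0 *.
have AT' := cstar_adj cstarA AT.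
have Ah : A h := cstar_comp cstarA AT' AT.
have hh : adj dot h = h.
  by rewrite /h (adj_comp hilbH (bA AT') (bA AT)) (adjK hilbH (bA AT)).
rewrite (ge0_nrm TT0) -nrmK -real_complexX lecR => le1.
have le2 : nrm (phi h) <= opnorm h.
  have := state_Re_le_opnorm sphi Ah hh.
  by rewrite [in X in X -> _](ge0_nrm TT0).
have le3 : opnorm h <= opnorm T ^+ 2.
  rewrite (le_trans (opnorm_comp (bA AT') (bA AT)))// expr2.
  by rewrite ler_wpM2r ?opnormA_ge0// (opnorm_adj hilbH)//; exact: bA.
rewrite -(@ler_pXn2r _ 2) ?nnegrE ?nrm_ge0 ?opnormA_ge0//.
exact: le_trans le1 (le_trans le2 le3).
Qed.

Lemma vector_state (x : H) : nrm x = 1 ->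
  exists2 phi, state dot A phi & forall T, A T -> phi T = dot (T x) x.
Proof.
move=> x1; exists (fun T => if `[< A T >] then dot (T x) x else 0); last first.
  by move=> T AT; rewrite asboolT.
split; [split=> [T nAT|c S T AS AT]| move=> T AT |].
- by rewrite asboolF.
- rewrite !asboolT//; last exact: (cstar_linear cstarA).
  by rewrite fctE dotDl dotZl.
- rewrite asboolT; last exact: (cstar_comp cstarA (cstar_adj cstarA AT) AT).
  rewrite /= dotC -(adjP hilbH (bA AT)) (dotxx hilbH) conj_real_complex.
  by rewrite ler0c sqr_ge0.
- by rewrite asboolT//= (dotxx hilbH) x1 expr1n.
Qed.

End States.

(** * Extreme points of compact sets *)

Section ExtremePoints.
Context {T : topologicalType} {R : realType}.
Implicit Types (F K C : set T) (x y z : T).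

(* The abstract Krein-Milman setting: [seg x y z] says that [x] is an inner
   point of the segment from [y] to [z].  All that is asked of the functions in
   [D] is continuity, that they separate points, and that one which is maximal
   at an inner point takes the same value at the end points. *)
Variables (seg : T -> T -> T -> Prop) (D : set (T -> R)).
Hypothesis D_continuous : forall f, D f -> continuous f.
Hypothesis D_separates : forall x y, (forall f, D f -> f x = f y) -> x = y.
Hypothesis D_affine : forall f x y z, D f -> seg x y z ->
  f y <= f x -> f z <= f x -> f y = f x /\ f z = f x.

Definition face_of K F := forall x y z, F x -> K y -> K z -> seg x y z ->
  F y /\ F z.

Definition extreme_in K x := K x /\
  forall y z, K y -> K z -> seg x y z -> y = x /\ z = x.

Definition maximizers F (f : T -> R) :=
  [set x | F x /\ forall y, F y -> f y <= f x].

Lemma maximizers_face K F f : compact K -> F `<=` K -> closed F -> F !=set0 ->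
  face_of K F -> D f ->
  [/\ closed (maximizers F f), maximizers F f !=set0 &
      face_of K (maximizers F f)].
Proof.
move=> cK FK clF F0 faceF Df.
have cF := subclosed_compact clF cK FK.
have cf := D_continuous Df.
have [c /set_mem Fc cmax] := compact_EVT_max F0 cF (continuous_subspaceT cf).
have {}cmax y : F y -> f y <= f c by move=> /mem_set; exact: cmax.
have -> : maximizers F f = F `&` f @^-1` [set v | f c <= v].
  apply/seteqP; split=> x [Fx /= xmax]; split=> //; first exact: xmax.
  by move=> y /cmax /le_trans; apply.
split.
- apply: closedI => //; apply: preimage_closed; last exact: closed_ge.
  by move=> x _; exact: cf.
- by exists c; split=> //=.
- move=> x y z [Fx /= xmax] Ky Kz s; have [Fy Fz] := faceF _ _ _ Fx Ky Kz s.
  have [fy fz] := D_affine Df s (le_trans (cmax _ Fy) xmax)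
    (le_trans (cmax _ Fz) xmax).
  by split; split=> //=; rewrite ?fy ?fz.
Qed.

(** A minimal nonempty closed face is a single point: by minimality it equals
    its set of maximizers for every [f] in [D], so that every [f] is constant on
    it.  Zorn's lemma is applied to the complements of the faces, because it is
    phrased with unions; compactness keeps the intersection of a chain
    nonempty. *)
Lemma exists_extreme K : compact K -> closed K -> K !=set0 ->
  exists x, extreme_in K x.
Proof.
move=> cK clK K0.
pose P C := [/\ open C, (K `\` C) !=set0 & face_of K (K `\` C)].
have [C [[oC C0 faceC] Cmax]] : exists C, P C /\ forall B, C `<` B -> ~ P B.
  apply: Zorn_bigcup => Q QP totQ.
  have [[X0 QX0]|Q0] := pselect (Q !=set0); last first.
    have -> : \bigcup_(X in Q) X = set0.
      by rewrite -subset0 => x [X QX _]; apply: Q0; exists X.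
    rewrite /P setD0; split=> //; first exact: open0.
  split.
  - by apply: bigcup_open => X /QP[].
  - pose B C := K `\` C.
    have FB : ProperFilter (filter_from Q B).
      apply: filter_from_proper => [|X /QP[]//]; apply: filter_from_filter.
        by exists X0.
      move=> X Y QX QY; have [XY|YX] := totQ _ _ QX QY.
        by exists Y => // x [Kx nYx]; split; split=> // /XY.
      by exists X => // x [Kx nXx]; split; split=> // /YX.
    have FK : filter_from Q B K by exists X0 => // x [].
    have [p [Kp pcl]] := cK _ FB FK; exists p; split=> // -[X QX Xp].
    have [oX _ _] := QP _ QX.
    have FX : filter_from Q B (B X) by exists X.
    by have [x [[_ nXx] Xx]] := pcl _ X FX (open_nbhs_nbhs (conj oX Xp)).
  - move=> x y z [Kx nQx] Ky Kz s.
    have yz X : Q X -> ~ X y /\ ~ X z.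
      move=> QX; have [_ _ faceX] := QP _ QX.
      have [|[_ ?] [_ ?]//] := faceX x y z _ Ky Kz s.
      by split=> // Xx; apply: nQx; exists X.
    by split; split=> // -[X QX Xw]; have [] := yz X QX.
have [x0 [Kx0 Cx0]] := C0.
have clF : closed (K `\` C) by apply: closedI => //; exact: open_closedC.
have const f x : D f -> (K `\` C) x -> f x = f x0.
  move=> Df Fx.
  have FK : K `\` C `<=` K by move=> ? [].
  have [clM M0 faceM] := maximizers_face cK FK clF C0 faceC Df.
  have KM : K `\` ~` maximizers (K `\` C) f = maximizers (K `\` C) f.
    rewrite setDE setCK; apply/setIidr => y [[]//].
  have inM : K `\` C `<=` maximizers (K `\` C) f.
    move=> y [Ky nCy]; apply: contrapT => nMy.
    apply: (Cmax (~` maximizers (K `\` C) f)); last first.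
      by rewrite /P KM; split=> //; exact: closed_openC.
    split=> [w Cw [[_]]//|/(_ y nMy)//].
  have [_ max1] := inM _ Fx; have [_ max2] := inM x0 (conj Kx0 Cx0).
  by apply/eqP; rewrite eq_le max1 ?max2.
exists x0; split=> // y z Ky Kz s.
have [Fy Fz] := faceC _ _ _ (conj Kx0 Cx0) Ky Kz s.
by split; apply: D_separates => f Df; exact: const.
Qed.

(** The maximizers of [f] form a face of [K], so that the extreme points of this
    face are extreme in [K]. *)
Lemma exists_extreme_maximizer K f : compact K -> closed K -> K !=set0 ->
  D f -> exists2 x, extreme_in K x & forall y, K y -> f y <= f x.
Proof.
move=> cK clK K0 Df.
have [|clM M0 faceM] :=
  @maximizers_face K K f cK (@subset_refl _ K) clK K0 _ Df.
  by move=> x y z _ Ky Kz _.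
have MK : maximizers K f `<=` K by move=> x [].
have [x [[Kx xmax] xext]] :=
  exists_extreme (subclosed_compact clM cK MK) clM M0.
exists x => //; split=> // y z Ky Kz s.
by have [My Mz] := faceM _ _ _ (conj Kx xmax) Ky Kz s; exact: xext.
Qed.

End ExtremePoints.

(** * Pure states that attain the norm *)

Section ComplexTopology.
Context {R : realType}.

Lemma nonexpansive_continuous (f : R[i]^o -> R) :
  (forall x y, `|f x - f y| <= nrm (x - y)) -> continuous f.
Proof.
move=> fle x; apply/(@cvgrPdist_le _ _ _ (nbhs x) (nbhs_filter x)) => e e0.
apply/nbhs_ballP; exists e%:C => [|y]; first by rewrite /= ltcR.
rewrite -ball_normE /= -nrmK ltcR => /ltW; exact: le_trans (fle x y).
Qed.

Lemma Re_continuous : continuous (@complex.Re R : R[i]^o -> R).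
Proof.
apply: nonexpansive_continuous => x y; apply: le_trans (Re_le_nrm (x - y)).
by case: x; case: y.
Qed.

Lemma Im_continuous : continuous (@complex.Im R : R[i]^o -> R).
Proof.
apply: nonexpansive_continuous => x y; apply: le_trans (Im_le_nrm (x - y)).
by case: x; case: y.
Qed.

Lemma real_complex_continuous : continuous (real_complex R : R -> R[i]^o).
Proof.
move=> x; apply/cvgrPdist_le => e e0.
have eE := ge0_RReK (ltW e0).
apply/nbhs_ballP; exists (complex.Re e) => [|y xy].
  by rewrite /= -ltcR eE.
have {xy} : `|x - y| < complex.Re e by exact: xy.
by move=> /ltW; rewrite -nrmK -eE lecR -(rmorphB (real_complex R)) nrmC.
Qed.

Lemma compact_square (K : R) :
  compact [set z : R[i]^o | `|complex.Re z| <= K /\ `|complex.Im z| <= K].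
Proof.
have -> : [set z : R[i]^o | `|complex.Re z| <= K /\ `|complex.Im z| <= K] =
    (fun p : R * R => p.1%:C + 'i%C * p.2%:C : R[i]^o) @`
      (`[- K, K] `*` `[- K, K]).
  apply/seteqP; split=> [z [re im]|z [[a b] /= []]].
    exists (complex.Re z, complex.Im z); last by rewrite [RHS]complexE.
    by rewrite /= !in_itv /= -!ler_norml.
  rewrite !in_itv /= -!ler_norml => aK bK <-.
  have -> : a%:C + 'i%C * b%:C = a +i* b by rewrite [RHS]complexE.
  by split.
apply: continuous_compact; last by apply: compact_setX; exact: segment_compact.
apply: continuous_subspaceT => p; apply: cvgD.
  by apply: (@cvg_comp _ _ _ fst (real_complex R : R -> R[i]^o));
    [exact: cvg_fst|exact: real_complex_continuous].
apply: cvgM; first exact: cvg_cst.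
by apply: (@cvg_comp _ _ _ snd (real_complex R : R -> R[i]^o));
  [exact: cvg_snd|exact: real_complex_continuous].
Qed.

Lemma closed_complex0 : closed [set z : R[i]^o | z = 0].
Proof.
have -> : [set z : R[i]^o | z = 0] =
    @complex.Re R @^-1` [set x | x = 0] `&` @complex.Im R @^-1` [set x | x = 0].
  apply/seteqP; split=> [z /= ->//|[a b] [/= -> ->]//].
apply: closedI; apply: preimage_closed; try exact: closed_eq.
  by move=> x _; exact: Re_continuous.
by move=> x _; exact: Im_continuous.
Qed.

Lemma closed_complex_ge0 : closed [set z : R[i]^o | 0 <= z].
Proof.
have -> : [set z : R[i]^o | 0 <= z] =
    @complex.Re R @^-1` [set x | 0 <= x] `&`
    @complex.Im R @^-1` [set x | x = 0].
  apply/seteqP; split=> z /=; rewrite lecE /=; first by move=> /andP[/eqP].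
  by move=> [-> ->]; rewrite eqxx.
apply: closedI; apply: preimage_closed; [|exact: closed_ge| |exact: closed_eq].
  by move=> x _; exact: Re_continuous.
by move=> x _; exact: Im_continuous.
Qed.

Lemma continuous_linear_defect (X : topologicalType) (c : R[i])
    (f g h : X -> R[i]^o) :
  continuous f -> continuous g -> continuous h ->
  continuous (fun x => f x - (c * g x + h x) : R[i]^o).
Proof.
move=> cf cg ch x.
exact: (cvgB (cf x) (cvgD (cvgM (cvg_cst (c : R[i]^o)) (cg x)) (ch x))).
Qed.

End ComplexTopology.

Section PureStates.
Context {R : realType} {H : completeNormedModType R[i]}.
Variable dot : {dot H for (@Num.conj R[i])}.
Hypothesis hilbH : hilbert_dot dot.
Variable A : set (H -> H).
Hypotheses (cstarA : cstar_subalgebra dot A) (A1 : A idfun).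
Implicit Types (S T : H -> H) (phi : functional H).

Let eval T (phi : functional H) : R[i]^o := phi T.

Lemma eval_continuous T : continuous (eval T).
Proof. exact: (@proj_continuous _ (fun _ : H -> H => R[i]^o) T). Qed.

Lemma Re_eval_continuous T :
  continuous (fun phi : functional H => complex.Re (phi T)).
Proof.
move=> phi; apply: (@continuous_comp _ _ _ (eval T) (@complex.Re R)).
  exact: eval_continuous.
exact: Re_continuous.
Qed.

Lemma Im_eval_continuous T :
  continuous (fun phi : functional H => complex.Im (phi T)).
Proof.
move=> phi; apply: (@continuous_comp _ _ _ (eval T) (@complex.Im R)).
  exact: eval_continuous.
exact: Im_continuous.
Qed.

Lemma closed_state : closed (state dot A).
Proof.
have -> : state dot A =
    \bigcap_(T in ~` A) eval T @^-1` [set z | z = 0]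
    `&` \bigcap_(q in [set q : R[i] * (H -> H) * (H -> H) | A q.1.2 /\ A q.2])
      (fun phi : functional H => phi (q.1.1 *: q.1.2 + q.2) -
        (q.1.1 * phi q.1.2 + phi q.2) : R[i]^o) @^-1` [set z | z = 0]
    `&` \bigcap_(T in A) eval (adj dot T \o T) @^-1` [set z | 0 <= z]
    `&` (fun phi : functional H => phi idfun - (0 * phi idfun + 1) : R[i]^o)
      @^-1` [set z | z = 0].
  apply/seteqP; split=> [phi [[phi0 philin] phipos phi1]|
      phi [[[phi0 philin] phipos] phi1]].
    split; last by rewrite /= phi1 mul0r add0r subrr.
    split; last by move=> T /phipos.
    split=> [T /phi0//|[[c S] T] /= [AS AT]].
    by rewrite philin// subrr.
  split=> [|T /phipos//|].
    split=> [T /phi0//|c S T AS AT].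
    by apply/eqP; rewrite -subr_eq0; apply/eqP/(philin (c, S, T)).
  by move: phi1; rewrite /= mul0r add0r => /eqP; rewrite subr_eq0 => /eqP.
apply: closedI; [apply: closedI; [apply: closedI|]|].
- apply: closed_bigI => T _; apply: preimage_closed closed_complex0.
  by move=> phi _; exact: eval_continuous.
- apply: closed_bigI => -[[c S] T] _; apply: preimage_closed closed_complex0.
  move=> phi _; apply: (@continuous_linear_defect _ _ c
    (eval (c *: S + T)) (eval S) (eval T)); exact: eval_continuous.
- apply: closed_bigI => T _; apply: preimage_closed closed_complex_ge0.
  by move=> phi _; exact: eval_continuous.
- apply: preimage_closed closed_complex0 => phi _.
  apply: (@continuous_linear_defect _ _ 0
    (eval idfun) (eval idfun) (fun=> 1 : R[i]^o)).
  - exact: eval_continuous.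
  - exact: eval_continuous.
  - exact: cst_continuous.
Qed.

(** States take values in bounded sets, so that Tychonoff's theorem applies. *)
Lemma compact_state : compact (state dot A).
Proof.
pose sq T := [set z : R[i]^o |
  `|complex.Re z| <= `|opnorm T| /\ `|complex.Im z| <= `|opnorm T|].
have csq : compact [set phi : functional H | forall T, sq T (phi T)].
  by apply: tychonoff => T; exact: compact_square.
apply: subclosed_compact closed_state csq _ => phi sphi T.
have [AT|nAT] := pselect (A T); last first.
  have [[phi0 _] _ _] := sphi; rewrite (phi0 _ nAT) /sq /= normr0.
  by split; exact: normr_ge0.
have le1 := state_le_opnorm hilbH cstarA A1 sphi AT.
have le2 := le_trans le1 (ler_norm _).
by split; [exact: le_trans (Re_le_nrm _) le2|
           exact: le_trans (Im_le_nrm _) le2].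
Qed.

(** The maximum of [phi (T^* T)] over all states is at most [opnorm T ^+ 2]
    because states have norm 1, and at least that much because of the vector
    states.  A state that is extreme among those where it is attained is
    pure. *)
Lemma exists_pure_state T : A T -> 0 < opnorm T ->
  exists2 phi, pure_state dot A phi & phi (adj dot T \o T) = (opnorm T ^+ 2)%:C.
Proof.
move=> AT T0.
have bT := cstar_bounded cstarA AT.
have ATT : A (adj dot T \o T) := cstar_comp cstarA (cstar_adj cstarA AT) AT.
pose seg (phi phi1 phi2 : functional H) := exists2 t : R, 0 < t < 1 &
  forall S, phi S = t%:C * phi1 S + (1 - t)%:C * phi2 S.
pose D : set (functional H -> R) := [set f | exists S,
  f = (fun phi => complex.Re (phi S)) \/ f = (fun phi => complex.Im (phi S))].
pose f0 (phi : functional H) := complex.Re (phi (adj dot T \o T)).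
have Dcont f : D f -> continuous f.
  by move=> [S [->|->]]; [exact: Re_eval_continuous|exact: Im_eval_continuous].
have Dsep phi psi : (forall f, D f -> f phi = f psi) -> phi = psi.
  move=> fE; apply/funext => S; apply/eqP; rewrite eq_complex.
  by apply/andP; split; apply/eqP;
    apply: (fE (fun phi => _ (phi S))); exists S; [left|right].
have Dseg f phi phi1 phi2 : D f -> seg phi phi1 phi2 -> f phi1 <= f phi ->
    f phi2 <= f phi -> f phi1 = f phi /\ f phi2 = f phi.
  move=> Df [t /andP[t0 t1] phiE].
  have -> : f phi = t * f phi1 + (1 - t) * f phi2.
    move: Df => [S [->|->]]; rewrite phiE;
      by case: (phi1 S) (phi2 S) => [a b] [c d] /=; ring.
  move=> le1 le2; split; apply/eqP; rewrite eq_le ?le1 ?le2 /=; nra.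
have Df0 : D f0 by exists (adj dot T \o T); left.
have pos phi : state dot A phi -> phi (adj dot T \o T) = (f0 phi)%:C.
  by move=> [_ phipos _]; rewrite /f0 ge0_RReK// phipos.
have vec x : nrm x = 1 ->
    exists2 phi, state dot A phi & f0 phi = nrm (T x) ^+ 2.
  move=> x1; have [phi sphi phiE] := vector_state hilbH cstarA A1 x1.
  exists phi => //; rewrite /f0 phiE//= dotC -(adjP hilbH bT) (dotxx hilbH).
  by rewrite conj_real_complex.
have nz (x : H) : x != 0 ->
    exists2 c : R[i], nrm (c *: x) = 1 & nrm c = (nrm x)^-1.
  move=> x0; exists (nrm x)^-1%:C; last first.
    by rewrite nrmC ger0_norm// invr_ge0 nrm_ge0.
  rewrite nrmZ nrmC ger0_norm ?invr_ge0 ?nrm_ge0// mulVf//.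
  by apply: contra x0 => /eqP/nrm_eq0 ->.
have K0 : state dot A !=set0.
  have [x x0] : exists x : H, x != 0.
    apply: contrapT => noH; have : opnorm T <= 0.
      apply: opnorm_le => // x.
      have -> : T x = 0 by apply: contrapT => /eqP Tx; apply: noH; exists (T x).
      by rewrite nrm0 mul0r.
    by rewrite leNgt T0.
  have [c cx _] := nz x x0; have [phi sphi _] := vec _ cx; by exists phi.
have [phi [sphi phiext] phimax] :=
  exists_extreme_maximizer Dcont Dsep Dseg compact_state closed_state K0 Df0.
exists phi.
  split=> // t phi1 phi2 t01 s1 s2 phiE.
  by apply: phiext => //; exists t.
rewrite pos//; congr _%:C; apply/eqP; rewrite eq_le; apply/andP; split.
  have le1 := state_le_opnorm hilbH cstarA A1 sphi ATT.
  rewrite pos// nrmC in le1; apply: le_trans (ler_norm _) (le_trans le1 _).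
  rewrite (le_trans (opnorm_comp (bounded_operator_adj hilbH bT) bT))// expr2.
  by rewrite ler_wpM2r ?(ltW T0)// (opnorm_adj hilbH).
have f0_ge0 : 0 <= f0 phi by rewrite -ler0c -pos//; case: sphi => _ + _; exact.
rewrite -[leRHS]sqr_sqrtr// ler_pXn2r ?nnegrE ?sqrtr_ge0 ?(ltW T0)//.
apply: opnorm_le; first exact: sqrtr_ge0.
move=> x; have [->|x0] := eqVneq x 0.
  by rewrite (linear_op0 bT.1) !nrm0 mulr0.
have nx0 : 0 < nrm x.
  by rewrite lt_def nrm_ge0 andbT; apply: contra x0 => /eqP/nrm_eq0 ->.
have [c cx nc] := nz x x0; have [psi spsi psiE] := vec _ cx.
rewrite -ler_pdivrMr// mulrC -nc -nrmZ -(linear_opZ _ _ bT.1).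
rewrite -(@ler_pXn2r _ 2) ?nnegrE ?nrm_ge0 ?sqrtr_ge0// sqr_sqrtr// -psiE.
exact: phimax.
Qed.

End PureStates.

(** * Localization over the center *)

Section Localization.
Context {R : realType} {H : completeNormedModType R[i]}.
Variable dot : {dot H for (@Num.conj R[i])}.
Hypothesis hilbH : hilbert_dot dot.
Variable A : set (H -> H).
Hypotheses (cstarA : cstar_subalgebra dot A) (A1 : A idfun).
Variable Z : set (H -> H).
Hypotheses (cstarZ : cstar_subalgebra dot Z) (Z1 : Z idfun) (ZA : Z `<=` A).
Implicit Types (S T z x : H -> H) (nu : functional H).

Lemma restrictionE nu z : Z z -> restriction Z nu z = nu z.
Proof. by move=> Zz; rewrite /restriction patchT//; exact: mem_set. Qed.

(** By the Cauchy-Schwarz inequality, [nu] vanishes on [(z - 1) x] as soon as it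
    vanishes on [(z - 1) (z - 1)^*], which it does because it is multiplicative
    on [Z] and [nu z = 1]. *)
Lemma state_absorb nu z x : state dot A nu -> character Z (restriction Z nu) ->
  Z z -> nu z = 1 -> A x -> nu (z \o x) = nu x.
Proof.
move=> snu [_ chM _] Zz nuz Ax; have [nulin nupos nu1] := snu.
have Zw : Z (z - idfun) := cstar_sub cstarZ Zz Z1.
have Zw' := cstar_adj cstarZ Zw.
have Aw' := ZA Zw'; have Aw := ZA Zw; have Az := ZA Zz.
have nuw : nu (z - idfun) = 0.
  have A1N : A (- idfun) by rewrite -scaleN1r; exact: (cstar_scale cstarA).
  rewrite (functionalD nulin Az A1N) nuz -scaleN1r -[_ *: _]addr0.
  rewrite nulin.2 //; last exact: (cstar0 cstarA).
  by rewrite nu1 (functional0 cstarA nulin) addr0 mulN1r subrr.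
have nuww : nu ((z - idfun) \o adj dot (z - idfun)) = 0.
  have := chM _ _ Zw Zw'; rewrite !restrictionE//;
    last exact: (cstar_comp cstarZ).
  by rewrite nuw mul0r.
have [_] := state_CauchySchwarz hilbH cstarA snu Aw' Ax.
rewrite (adjK hilbH (cstar_bounded cstarZ Zw)) nuww mul0r.
move=> le0; have {le0} : `|nu ((z - idfun) \o x)| ^+ 2 == 0.
  by rewrite eq_le le0 exprn_ge0.
rewrite expf_eq0 /= normr_eq0 => /eqP nuwx.
have -> : z \o x = ((z - idfun) \o x) + x.
  by apply/funext => v; rewrite !fctE /= subrK.
by rewrite (functionalD nulin) ?nuwx ?add0r//; exact: (cstar_comp cstarA).
Qed.

Hypothesis locA : localizable dot A Z.

(** Localizability makes the image under restriction of the open set of all pure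
    states a set of characters. *)
Lemma pure_state_character nu : pure_state dot A nu ->
  character Z (restriction Z nu).
Proof.
move=> pnu; have [|O _ WE] := locA (W := pure_state dot A).
  by exists setT; [exact: openT|rewrite setIT].
have : (restriction Z @` pure_state dot A) (restriction Z nu) by exists nu.
by rewrite WE => -[].
Qed.

(** A pure state where [z^* z] attains its norm 1 restricts to a character [m]
    with [`|m z|] equal to 1, and [m z] is nonnegative.  This character lies in
    the support of [z]. *)
Lemma bump_attained (V : set (functional H)) z : unit_bump Z V z ->
  exists2 m, V m & m z = 1.
Proof.
move=> [Zz z01 z1 zV]; have z0 : 0 < opnorm z by rewrite z1.
have [mu pmu muzz] := exists_pure_state hilbH cstarA A1 (ZA Zz) z0.
have chmu := pure_state_character pmu.
have Zz' := cstar_adj cstarZ Zz.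
have [smu _] := pmu.
set m := restriction Z mu in chmu *.
have mz : m z = 1.
  have [_ mM _] := chmu.
  have := mM _ _ Zz' Zz; rewrite /m !restrictionE//;
    last exact: (cstar_comp cstarZ).
  rewrite muzz z1 expr1n.
  have [muz _] := state_CauchySchwarz hilbH cstarA smu (ZA Zz) A1.
  rewrite (adj_idfun hilbH) in muz.
  have -> : mu (adj dot z) = Num.conj (mu z).
    by rewrite -[in RHS](_ : idfun \o z = z)// muz conjCK.
  have /andP[mz0 _] := z01 _ chmu; rewrite /m restrictionE// in mz0.
  rewrite (ge0_nrm mz0) conj_real_complex -real_complexM.
  move=> /complexI /esym/eqP; rewrite -expr2 sqrf_eq1.
  move=> /orP[/eqP -> //|/eqP n1].
  by have := nrm_ge0 (mu z); rewrite n1 ler0N1.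
exists m => //; apply: zV; split=> //; apply: subset_closure; split=> //.
by rewrite mz oner_neq0.
Qed.

Lemma bump_pure_state (W : set (functional H)) z :
  open_in (pure_state dot A) W -> unit_bump Z (restriction Z @` W) z ->
  exists nu, [/\ W nu, pure_state dot A nu & restriction Z nu z = 1].
Proof.
move=> oW /bump_attained[_ [nu Wnu <-] nuz]; exists nu; split=> //.
by have [Q _ WE] := oW; move: Wnu; rewrite WE => -[].
Qed.

End Localization.

(** * Sums of translates *)

Section TrigonometricSums.
Context {R : realType} {H : completeNormedModType R[i]}.
Variable dot : {dot H for (@Num.conj R[i])}.
Hypothesis hilbH : hilbert_dot dot.
Variable A : set (H -> H).
Hypotheses (cstarA : cstar_subalgebra dot A) (A1 : A idfun).
Variables (G : groupType) (U : G -> H -> H).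
Hypothesis repU : unitary_rep dot U.
Hypothesis autA : forall g, star_automorphism dot A (alpha dot U g).
Variables (G0 : {fset G}) (a : G -> H -> H).
Hypothesis aA : forall g, g \in G0 -> A (a g).

Local Notation term g := (alpha dot U g^-1%g (adj dot (a g) \o a g)).

Lemma alphaA g T : A T -> A (alpha dot U g T).
Proof. by have [[funA _ _] _ _ _] := autA g; exact: funA. Qed.

Lemma alpha1 T : alpha dot U 1%g T = T.
Proof. by have [_ U1 _] := repU; rewrite /alpha U1 (adj_idfun hilbH). Qed.

Lemma termA g : g \in G0 -> A (term g).
Proof.
move=> /aA Aa; apply/alphaA/(cstar_comp cstarA) => //.
exact: (cstar_adj cstarA).
Qed.

Lemma term_ge0 nu g : state dot A nu -> g \in G0 -> 0 <= nu (term g).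
Proof.
move=> [_ nupos _] /aA Aa.
have [_ _ alphaM alphaS] := autA g^-1%g.
by rewrite (alphaM _ _ (cstar_adj cstarA Aa) Aa) alphaS//; exact/nupos/alphaA.
Qed.

Lemma state_sum_ge nu : state dot A nu -> 1%g \in G0 ->
  nu (adj dot (a 1%g) \o a 1%g) <= nu (\sum_(g <- G0) term g).
Proof.
move=> snu G01; have [nulin _ _] := snu.
rewrite (functional_sum cstarA nulin termA) (bigD1_seq 1%g)//=;
  last exact: fset_uniq.
rewrite invg1 alpha1 lerDl big_seq_cond sumr_ge0// => g /andP[gG0 _].
exact: term_ge0.
Qed.

Lemma bounded_trig_sum : bounded_operator (\sum_(g <- G0) (a g \o U g)).
Proof.
have [uU _ _] := repU.
apply: bounded_operator_sum => g /aA Aa; apply: bounded_operator_comp.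
  exact: (cstar_bounded cstarA).
by case: (uU g).
Qed.

End TrigonometricSums.

(** * The coefficient at the identity *)

Theorem proposition3 (R : realType) (H : completeNormedModType R[i])
  (dot : {dot H for (@Num.conj R[i])}) (hilbH : hilbert_dot dot)
  (A : set (H -> H)) (cstarA : cstar_subalgebra dot A) (A1 : A idfun)
  (G : groupType) (U : G -> H -> H) (repU : unitary_rep dot U)
  (Z : set (H -> H)) (cstarZ : cstar_subalgebra dot Z) (ZA : Z `<=` A)
  (centralZ : forall z a, Z z -> A a -> z \o a = a \o z) (Z1 : Z idfun)
  (autA : forall g, star_automorphism dot A (alpha dot U g))
  (autZ : forall g, star_automorphism dot Z (alpha dot U g))
  (locA : localizable dot A Z)
  (G0 : {fset G}) (a : G -> H -> H) (aA : forall g, g \in G0 -> A (a g)) :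
  let b : H -> H := \sum_(g <- G0) (a g \o U g) in
  let ta : H -> H := \sum_(g <- G0) alpha dot U g^-1%g (adj dot (a g) \o a g) in
  let ae : H -> H := if 1%g \in G0 then a 1%g else 0 in
  let M := character Z in
  ((forall V : set (functional H), open_in M V -> V !=set0 ->
      exists2 z, unit_bump Z V z &
        opnorm (z \o ta) <= opnorm (z \o (adj dot b \o b))) ->
   opnorm ae <= opnorm b)
  /\
  ((forall V : set (functional H), open_in M V -> V !=set0 ->
      exists2 z, unit_bump Z V z &
        forall nu, pure_state dot A nu -> restriction Z nu z = 1 ->
          nu (z \o ta) <= (opnorm (z \o (adj dot b \o b)))%:C) ->
   opnorm ae <= opnorm b).
Proof.
move=> b ta ae M.
have bb : bounded_operator b by exact: (bounded_trig_sum cstarA repU aA).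
have Ata : A ta.
  by apply: (cstar_sum cstarA) => g gG0; exact: (termA cstarA autA aA).
have absorb z nu : Z z -> pure_state dot A nu -> restriction Z nu z = 1 ->
    nu (z \o ta) = nu ta.
  move=> Zz pnu; rewrite (restrictionE _ Zz) => nuz.
  have chnu := pure_state_character locA pnu; have [snu _] := pnu.
  exact: (state_absorb hilbH cstarA A1 cstarZ Z1 ZA snu chnu Zz nuz Ata).
(* the second hypothesis follows from the first one, because states are
   bounded by the norm *)
have weak : (forall V, open_in M V -> V !=set0 -> exists2 z, unit_bump Z V z &
      forall nu, pure_state dot A nu -> restriction Z nu z = 1 ->
        nu (z \o ta) <= (opnorm (z \o (adj dot b \o b)))%:C) ->
    opnorm ae <= opnorm b.
  move=> hyp; rewrite /ae; case: ifP => [G01|_]; last first.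
    apply: opnorm_le => [|x]; first exact: opnorm_ge0.
    by rewrite nrm0 mulr_ge0 ?opnorm_ge0 ?nrm_ge0.
  set T := a 1%g; have AT : A T := aA _ G01.
  have [T0|T0] := leP (opnorm T) 0; first exact: le_trans T0 (opnorm_ge0 bb).
  rewrite -(@ler_pXn2r _ 2) ?nnegrE ?(opnorm_ge0 bb) ?(ltW T0)//.
  apply/ler_addgt0Pr => e e0.
  pose O := [set phi : functional H |
    opnorm T ^+ 2 - e < complex.Re (phi (adj dot T \o T))].
  have oO : open O.
    apply: (@open_comp _ _
      (fun phi : functional H => complex.Re (phi (adj dot T \o T)))
      [set x | opnorm T ^+ 2 - e < x]); last exact: open_gt.
    by move=> phi _; exact: Re_eval_continuous.
  pose W := pure_state dot A `&` O.
  have oW : open_in (pure_state dot A) W by exists O.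
  have [mu pmu muT] := exists_pure_state hilbH cstarA A1 AT T0.
  have W0 : (restriction Z @` W) !=set0.
    exists (restriction Z mu), mu => //; split=> //.
    by rewrite /O /= muT /= ltrBlDr ltrDl.
  have [z zV zP] := hyp _ (locA _ oW) W0.
  have [nu [[_ Onu] pnu nuz]] :=
    bump_pure_state hilbH cstarA A1 cstarZ ZA locA oW zV.
  have [Zz _ z1 _] := zV; have [snu _] := pnu.
  have := zP _ pnu nuz; rewrite (absorb _ _ Zz pnu nuz).
  move/(le_trans (state_sum_ge hilbH cstarA repU autA aA snu G01)).
  rewrite lecE /= => /andP[_ le1].
  have le2 : opnorm (z \o (adj dot b \o b)) <= opnorm b ^+ 2.
    have bz := cstar_bounded cstarZ Zz.
    have bb' := bounded_operator_adj hilbH bb.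
    rewrite (le_trans (opnorm_comp bz (bounded_operator_comp bb' bb)))//.
    rewrite z1 mul1r (le_trans (opnorm_comp bb' bb))// expr2.
    rewrite ler_wpM2r ?(opnorm_ge0 bb)//.
    exact: opnorm_adj.
  by rewrite -lerBlDr (le_trans (ltW Onu))// (le_trans le1).
split=> [hyp|]; last exact: weak.
apply: weak => V oV V0; have [z zV zle] := hyp V oV V0.
exists z => // nu pnu nuz; have [Zz _ _ _] := zV; have [snu _] := pnu.
have nuta : 0 <= nu (z \o ta).
  rewrite (absorb _ _ Zz pnu nuz) /ta.
  have [nulin _ _] := snu.
  rewrite (functional_sum cstarA nulin (termA cstarA autA aA)).
  rewrite big_seq sumr_ge0//.
  by move=> g gG0; exact: (term_ge0 cstarA autA aA).
rewrite (ge0_nrm nuta) lecR (le_trans _ zle)//.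
apply: (state_le_opnorm hilbH cstarA A1 snu).
exact: (cstar_comp cstarA (ZA _ Zz) Ata).
Qed.
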